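(* Let $n\ge 1$ be an integer, let $E$ be a Hilbert space and let $\tau$ be a Hausdorff topology on $E$. Let $\{T(p): p\in\mathbb{R}_+^n\}$ be an $n$-parameter $\tau$-continuous semigroup of nonexpansive mappings on a bounded closed convex subset $C$ of $E$. Let $p_1,\dots,p_n\in\mathbb{R}_+^n$ be linearly independent (over $\mathbb{R}$, in the usual sense). Let $\alpha_1,\dots,\alpha_n\in\mathbb{R}$ be such that $\{1,\alpha_1,\dots,\alpha_n\}$ is linearly independent over $\mathbb{Q}$ and $p_0=\alpha_1p_1+\cdots+\alpha_np_n\in\mathbb{R}_+^n$. Let $\lambda_0,\lambda_1,\dots,\lambda_n\in(0,1)$ with $\sum_{j=0}^n\lambda_j=1$. Define a nonexpansive mapping $S$ on $C$ by $Sx=\sum_{j=0}^n\lambda_jT(p_j)x$ for $x\in C$. Let $\{s_k\}$ and $\{t_k\}$ be sequences in $(0,1)$ satisfying $$\lim_{k\to\infty}s_k=\lim_{k\to\infty}t_k=0,\qquad\sum_{k=1}^\infty t_k=\infty,\qquad\sum_{k=1}^\infty|t_{k+1}-t_k|<\infty.$$ Let $u\in C$ and $y_1\in C$, and define sequences $\{x_k\}$ and $\{y_k\}$ in $C$ by $$x_k=(1-s_k)Sx_k+s_ku,\qquad y_{k+1}=(1-t_k)Sy_k+t_ku\qquad(k\in\mathbb{N}),$$ where $x_k$ is the (unique) point of $C$ satisfying the first equation. Then each of $\{x_k\}$ and $\{y_k\}$ converges strongly to a common fixed point of $\{T(p): p\in\mathbb{R}_+^n\}$.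
   Context: $\mathbb{N}$ is the set of positive integers and $\mathbb{R}_+^n=[0,\infty)^n$. A family $\{T(p): p\in\mathbb{R}_+^n\}$ of mappings from $C$ into $C$ is an $n$-parameter $\tau$-continuous semigroup of nonexpansive mappings on $C$ if (sg 1) $T(p+q)=T(p)\circ T(q)$ for all $p,q\in\mathbb{R}_+^n$; (sg 2) for each $x\in C$, the map $p\mapsto T(p)x$ from $\mathbb{R}_+^n$ into $C$ is continuous with respect to $\tau$; and (sg 3) each $T(p)$ is nonexpansive, i.e. $\|T(p)x-T(p)y\|\le\|x-y\|$ for all $x,y\in C$. A common fixed point is a $z\in C$ with $T(p)z=z$ for all $p\in\mathbb{R}_+^n$. Real numbers $\{\gamma_1,\dots,\gamma_m\}$ are linearly independent over $\mathbb{Q}$ if there is no nonzero $(\nu_1,\dots,\nu_m)\in\mathbb{Z}^m$ with $\sum_i\nu_i\gamma_i=0$. *)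

(* Defs.v *)
From HB Require Import structures.
From mathcomp Require Import all_boot all_order all_algebra.
From mathcomp Require Import all_classical all_reals all_analysis.

Set Implicit Arguments.
Unset Strict Implicit.
Unset Printing Implicit Defensive.

Import Order.TTheory GRing.Theory Num.Theory.
Import numFieldNormedType.Exports.
Local Open Scope classical_set_scope.
Local Open Scope ring_scope.

(* The inner product [dot] is the one inducing the (complete) norm of [E]:
   together with [E : completeNormedModType R] this makes [E] a real Hilbert
   space. *)
Definition induces_norm (R : realType) (E : completeNormedModType R)
    (dot : {dot E for idfun}) :=
  forall x : E, `|x| ^+ 2 = dot x x.

(* [E] already carries its norm topology, so a second, arbitrary topology on
   the same carrier is taken as an explicit topological structure, and
   [retopologize tau] is the carrier equipped with it.  (The eqType and
   choiceType structures that such a structure also bundles play no role.) *)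
Definition topology_on (T : Type) := Topological.axioms_ T.

Definition retopologize (T : Type) (tau : topology_on T) : topologicalType :=
  Topological.Pack tau.

Definition nonneg_orthant (R : realType) (n : nat) : set 'rV[R]_n :=
  [set p | forall i, 0 <= p ord0 i].
Arguments nonneg_orthant : clear implicits.

Definition nonexpansive_on (R : realType) (E : normedModType R) (C : set E)
    (f : E -> E) :=
  forall x y, C x -> C y -> `|f x - f y| <= `|x - y|.

(* Mappings from C into C indexed by the orthant are total functions
   constrained only on the orthant and on C.  No condition is put on T(0). *)
Record nonexpansive_semigroup (R : realType) (E : normedModType R) (n : nat)
    (tau : topology_on E) (C : set E) (T : 'rV[R]_n -> E -> E) : Prop := {
  semigroup_into : forall p x, nonneg_orthant R n p -> C x -> C (T p x);
  semigroupD : forall p q x, nonneg_orthant R n p -> nonneg_orthant R n q ->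
    C x -> T (p + q) x = T p (T q x);
  semigroup_continuous : forall x, C x ->
    {within nonneg_orthant R n,
      continuous (fun p => T p x : retopologize tau)};
  semigroup_nonexpansive : forall p, nonneg_orthant R n p ->
    nonexpansive_on C (T p)
}.

Definition common_fixed_point (R : realType) (E : normedModType R) (n : nat)
    (C : set E) (T : 'rV[R]_n -> E -> E) (z : E) :=
  C z /\ forall p, nonneg_orthant R n p -> T p z = z.

Definition linearly_independent_over_Q (R : realType) (m : nat)
    (gamma : m.-tuple R) :=
  ~ exists2 nu : 'I_m -> int, (exists i, nu i != 0) &
      \sum_(i < m) (nu i)%:~R * tnth gamma i = 0.

(* Main.v *)
Require Import Defs.
From HB Require Import structures.
From mathcomp Require Import all_boot all_order all_algebra.
From mathcomp Require Import all_classical all_reals all_analysis.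
From mathcomp Require Import complex ring lra zify.

Set Implicit Arguments.
Unset Strict Implicit.
Unset Printing Implicit Defensive.

Import Order.TTheory GRing.Theory Num.Theory.
Import numFieldNormedType.Exports.
Local Open Scope classical_set_scope.
Local Open Scope ring_scope.

(** By Kronecker's theorem the group generated by p_0, ..., p_n is dense in R^n,
    so its elements in the orthant are dense there; a common fixed point of the
    T(p_j) is fixed by these, hence, by tau-continuity, by every T(p).  The
    commuting maps T(p_j) have a common fixed point w, and since w is fixed and
    |T(p_j) z - w| <= |z - w|, strict convexity shows that any z = S z satisfies
    T(p_j) z = z.  It remains to find fixed points of S.  The map I - S is
    monotone, which gives, with r = s / (1 - s) and q = t / (1 - t),
      (r + q) |x_s - x_t|^2 + (r - q) (|x_s - u|^2 - |x_t - u|^2) <= 0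
    for x_s = (1 - s) S x_s + s u: the curve x_s is Cauchy as s -> 0 (Browder,
    Halpern), and its limit z satisfies <z - y, z - u> <= 0 approximately for all
    approximate fixed points y.  With this inequality the scheme y_k converges to
    the same z (Wittmann). *)

(** * Kronecker's approximation theorem *)

Section expi.
Variable R : realType.
Implicit Types x y : R.

Definition expi x : R[i] := Complex (cos x) (sin x).

Lemma expiD x y : expi (x + y) = expi x * expi y.
Proof.
rewrite /expi cosD sinD; congr Complex; ring.
Qed.

Lemma expi0 : expi 0 = 1.
Proof. by rewrite /expi cos0 sin0. Qed.

Lemma expi_sum (I : finType) (f : I -> R) :
  expi (\sum_i f i) = \prod_i expi (f i).
Proof. exact: (big_morph expi expiD expi0). Qed.

Lemma expiMn x n : expi (x *+ n) = expi x ^+ n.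
Proof.
by elim: n => [|n IH]; rewrite ?mulr0n ?expi0// mulrS exprS expiD IH.
Qed.

Lemma norm_expi x : `|expi x| = 1.
Proof. by rewrite normc_def /= cos2Dsin2 sqrtr1. Qed.

Lemma expiN_sqr x : expi (- x) * (1 + expi x) ^+ 2 = (2 + 2 * cos x)%:C%C.
Proof.
have -> : expi (- x) * (1 + expi x) ^+ 2
   = expi (- x) + 2 * (expi (- x) * expi x) + (expi (- x) * expi x) * expi x.
  by ring.
rewrite -expiD addNr expi0 mulr1 mul1r; apply/eqP; rewrite eq_complex /= cosN sinN.
by apply/andP; split; apply/eqP; ring.
Qed.

Lemma cosDzpi x (k : int) : cos (x + 2 * pi * k%:~R) = cos x.
Proof.
have cosDn y n : cos (y + 2 * pi * n%:R) = cos y.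
  by rewrite mulr_natr [2 * pi]mulr_natl (periodicn (@cosD2pi R)).
case: (intP k) => [|n|n].
- by rewrite mulr0 addr0.
- exact: cosDn.
by rewrite mulrNz mulrN -(cosDn (x - _) n.+1) subrK.
Qed.

(** Rounding and the evenness of the cosine bring every angle into [[0, pi]], where the cosine is
    strictly decreasing. *)
Lemma cos_nearest_int x : exists k : int,
  `|x - k%:~R| <= 2^-1 /\ cos (2 * pi * x) = cos (2 * pi * `|x - k%:~R|).
Proof.
exists (Num.floor (x + 2^-1)); set k := Num.floor _; split.
  have := floor_itv (x + 2^-1); rewrite -/k intrD => /andP[h1 h2].
  by rewrite ler_norml; apply/andP; split; lra.
have -> : 2 * pi * `|x - k%:~R| = `|2 * pi * (x - k%:~R)|.
  by rewrite normrM ger0_norm// mulr_ge0// pi_ge0.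
by rewrite cos_norm -(cosDzpi (2 * pi * (x - k%:~R)) k) -mulrDr subrK.
Qed.

Let in_0pi y : 0 <= y <= 2^-1 -> 2 * pi * y \in `[0, pi :> R].
Proof.
move=> /andP[y0 y1]; rewrite in_itv/= !mulr_ge0 ?pi_ge0//=.
by have := pi_ge0 R => p0; nra.
Qed.

Lemma cos_far_int x e : 0 <= e -> (forall k : int, e <= `|x - k%:~R|) ->
  cos (2 * pi * x) <= cos (2 * pi * e).
Proof.
move=> e0 far; have [k [le_half ->]] := cos_nearest_int x.
have p0 := pi_gt0 R.
rewrite leNgt ltr_cos ?in_0pi ?normr_ge0 ?e0 ?(le_trans (far k))//=.
by rewrite ltr_pM2l ?mulr_gt0// -leNgt.
Qed.

Lemma cos_lt1 e : 0 < e <= 2^-1 -> cos (2 * pi * e) < 1 :> R.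
Proof.
move=> /andP[e0 e1]; rewrite -[X in _ < X]cos0.
have e_in : 2 * pi * e \in `[0, pi :> R] by rewrite in_0pi// (ltW e0).
have z_in : 0 \in `[0, pi :> R] by rewrite in_itv /= lexx pi_ge0.
by rewrite (ltr_cos z_in e_in) !mulr_gt0 ?pi_gt0.
Qed.

Lemma expi_eq1 x : expi (2 * pi * x) = 1 -> exists k : int, x = k%:~R.
Proof.
move=> [c1 _]; have [k [le_half ck]] := cos_nearest_int x.
exists k; apply/eqP; rewrite -subr_eq0 -normr_eq0; apply: contraT => nz.
have := @cos_lt1 `|x - k%:~R|; rewrite -ck c1 ltxx le_half andbT => -> //.
by rewrite lt_neqAle eq_sym nz normr_ge0.
Qed.

End expi.

(** The central coefficient is the constant term of [(2 + 2 cos t) ^ N], hence within a polynomial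
    factor of the peak [4 ^ N]. The relations [h2] and [h3] reduce the induction step to
    [4 (N + 1) <= 2 (2N + 3)]. *)
Lemma central_bin N : (4 ^ N <= N.*2.+1 * 'C(N.*2, N))%N.
Proof.
elim: N => [|N IH]; first by [].
have h1 : (N.+1 * 'C(N.+1.*2, N.+1) = N.+1.*2 * 'C(N.*2.+1, N))%N.
  by rewrite -mul_bin_diag.
have h2 : (N.*2.+1 * 'C(N.*2, N) = N.+1 * 'C(N.*2.+1, N))%N.
  rewrite (mul_bin_down N.*2.+1 N); congr (_ * _)%N; lia.
have h3 : 'C(N.+1.*2, N.+1) = (2 * 'C(N.*2.+1, N))%N.
  by apply/eqP; rewrite -(eqn_pmul2l (ltn0Sn N)) h1 -muln2 -mulnA.
rewrite expnS h3; nia.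
Qed.

(** Bernoulli's inequality gives [r ^- L >= L x]. Raised to the power [n.+1], this beats
    [(2N + 1) ^ n], which has degree only [n] in [L] when [N = L * n.+1]. *)
Lemma exp_polynomial_decay (R : archiRealFieldType) (n : nat) (r : R) :
  0 <= r < 1 -> exists N, (N.*2.+1)%:R ^+ n * r ^+ N < 1.
Proof.
move=> /andP[r0 r1].
have [->|rn0] := eqVneq r 0.
  by exists 1%N; rewrite expr1 mulr0 ltr01.
have rp : 0 < r by rewrite lt_neqAle eq_sym rn0.
pose x := r^-1 - 1.
have x0 : 0 < x by rewrite subr_gt0 invf_gt1.
have bern L : 1 + L%:R * x <= r^-1 ^+ L.
  elim: L => [|L IH]; first by rewrite mul0r addr0 expr0.
  rewrite exprS.
  apply: (le_trans (_ : _ <= r^-1 * (1 + L%:R * x))).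
    rewrite (_ : r^-1 = 1 + x); last by rewrite /x addrC subrK.
    rewrite -natr1 mulrDl; have : 0 <= (L%:R : R) by []. nra.
  by rewrite ler_pM2l ?invr_gt0.
(* Chosen so that [2N + 1 <= L c] for [N = L * n.+1] and [L >= 1]. *)
pose c : R := (n.+1.*2.+1)%:R.
have [L Lc] : exists L, c ^+ n < L%:R * x ^+ n.+1.
  exists (Num.trunc (c ^+ n / x ^+ n.+1)).+1.
  by rewrite -ltr_pdivrMr ?exprn_gt0// truncnS_gt.
have L0 : (0 < L)%N.
  case: L Lc => //; rewrite mul0r ltNge exprn_ge0//.
exists (L * n.+1)%N.
have rN : 0 < r ^+ (L * n.+1) by rewrite exprn_gt0.
rewrite -ltr_pdivlMr// mul1r -exprVn.
have h1 : ((L * n.+1).*2.+1)%:R ^+ n <= (L%:R * c) ^+ n.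
  rewrite lerXn2r ?nnegrE ?mulr_ge0// -natrM ler_nat; lia.
apply: (le_lt_trans h1); rewrite exprM.
apply: (@lt_le_trans _ _ ((L%:R * x) ^+ n.+1)); last first.
  rewrite lerXn2r ?nnegrE ?exprn_ge0 ?invr_ge0 ?mulr_ge0 ?(ltW x0)//.
  by apply: le_trans (bern L); rewrite lerDr.
have -> : (L%:R * x) ^+ n.+1 = L%:R ^+ n * (L%:R * x ^+ n.+1).
  by rewrite exprMn [L%:R ^+ n.+1]exprS -mulrA mulrCA.
by rewrite exprMn ltr_pM2l ?exprn_gt0 ?ltr0n.
Qed.

(** Each [w i] other than [w i0] contributes a geometric sum, bounded independently of [M]; so the
    average over [m] isolates the coefficient [c i0]. *)
Lemma exp_sum_mean (R : realType) (I : finType) (i0 : I) (c w : I -> R[i]) :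
  (forall i, `|w i| = 1) -> w i0 = 1 -> (forall i, i != i0 -> w i != 1) ->
  exists B : R, forall M : nat,
    `|\sum_(m < M) \sum_i c i * w i ^+ m - M%:R * c i0| <= B%:C%C.
Proof.
move=> w1 wi0 wi.
exists (complex.Re (\sum_(i | i != i0) `|c i| * (2 / `|1 - w i|))) => M.
rewrite RRe_real; last first.
  by apply: ger0_real; apply: sumr_ge0 => i _; rewrite mulr_ge0// divr_ge0.
rewrite exchange_big /= (bigD1 i0)//= wi0.
under eq_bigr do rewrite expr1n mulr1.
rewrite sumr_const card_ord mulr_natl addrAC subrr add0r.
apply: (le_trans (ler_norm_sum _ _ _)); apply: ler_sum => i ii0.
rewrite -mulr_sumr normrM ler_wpM2l//.
have nz : 1 - w i != 0 by rewrite subr_eq0 eq_sym wi.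
have -> : \sum_(m < M) w i ^+ m = (1 - w i ^+ M) / (1 - w i).
  apply: (mulIf nz); rewrite divfK// mulrC -[1 - _ ^+ M]opprB.
  by rewrite subrX1 -mulNr opprB.
rewrite normrM normfV ler_wpM2r ?invr_ge0//.
by rewrite (le_trans (ler_normB _ _))// normr1 normrX w1 expr1n.
Qed.

Section kronecker.
Variables (R : realType) (n : nat) (alpha : 'I_n -> R).
Hypothesis alpha_indep :
  linearly_independent_over_Q [tuple of 1 :: [tuple alpha i | i < n]].

Let Q_indep (m : int) (nu : 'I_n -> int) :
  \sum_(i < n) (nu i)%:~R * alpha i = m%:~R -> forall i, nu i = 0.
Proof.
move=> sumE i; apply/eqP; apply: contrapT => /negP nz; apply: alpha_indep.
exists (fun j => if unlift ord0 j is Some k then nu k else - m).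
  by exists (lift ord0 i); rewrite liftK.
rewrite big_ord_recl unlift_none tnth0 mulr1 intrN -sumE.
rewrite addrC -sumrB big1// => j _.
by rewrite liftK tnthS tnth_mktuple subrr.
Qed.

Let theta (beta : 'I_n -> R) (m : nat) j : R := 2 * pi * (m%:R * alpha j - beta j).

(* [expi (- t) * (1 + expi t) ^+ 2 = 2 + 2 cos t] makes the product kernel a
   trigonometric polynomial; its frequencies [f j - N] are the exponents of the
   binomial expansion of [(1 + expi t) ^+ N.*2]. *)
Let kernel_expansion beta N m :
  (\prod_j (2 + 2 * cos (theta beta m j)) ^+ N)%:C%C
  = \sum_(f : {ffun 'I_n -> 'I_N.*2.+1})
      (\prod_j ('C(N.*2, f j)%:R * expi (- (2 * pi * ((f j)%:R - N%:R) * beta j))))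
      * expi (\sum_j 2 * pi * ((f j)%:R - N%:R) * alpha j) ^+ m.
Proof.
rewrite rmorph_prod /=.
have factorE j : ((2 + 2 * cos (theta beta m j)) ^+ N)%:C%C
    = \sum_(k < N.*2.+1) 'C(N.*2, k)%:R
        * expi (2 * pi * (k%:R - N%:R) * (m%:R * alpha j - beta j)).
  rewrite rmorphXn /= -expiN_sqr exprMn -exprM mul2n -expiMn exprDn mulr_sumr.
  apply: eq_bigr => k _.
  rewrite expr1n mul1r mulrnAr -mulr_natl -expiMn -expiD.
  congr (_ * expi _); rewrite /theta -[_ *+ N]mulr_natr -[_ *+ k]mulr_natr.
  by ring.
under eq_bigr do rewrite factorE.
rewrite bigA_distr_bigA /=; apply: eq_bigr => f _.
rewrite expi_sum -prodrXl -big_split /=; apply: eq_bigr => j _.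
rewrite -[RHS]mulrA -expiMn -expiD; congr (_ * expi _).
by rewrite -[_ *+ m]mulr_natr; ring.
Qed.

(* Average over [m] the kernel [\prod_j (2 + 2 cos (theta beta m j)) ^+ N].  By
   independence only the zero frequency survives, so the mean is
   ['C(2N, N) ^ n >= (4 ^ N / (2N + 1)) ^ n]; without good approximations some
   factor of every kernel would be at most [(4 r) ^ N] with a fixed [r < 1]. *)
Lemma kronecker_density (beta : 'I_n -> R) (e : R) : 0 < e ->
  exists (m : nat) (k : 'I_n -> int),
    forall j, `|m%:R * alpha j + (k j)%:~R - beta j| < e.
Proof.
move=> e0; apply: contrapT => no_approx.
(* The cap [2^-1] keeps [2 pi d] in [[0, pi]], as [cos_lt1] requires. *)
pose d : R := Num.min e 2^-1.
have d0 : 0 < d by rewrite lt_min e0 invr_gt0 ltr0n.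
have d_half : d <= 2^-1 by rewrite ge_min lexx orbT.
(* [4 r] is the value of [2 + 2 cos] at the angle [2 pi d]: it bounds any factor whose argument
   stays [d] away from the integers. *)
pose r : R := (1 + cos (2 * pi * d)) / 2.
have r01 : 0 <= r < 1.
  have := cos_geN1 (2 * pi * d); have := @cos_lt1 R d; rewrite d0 d_half.
  by move=> /(_ isT) ? ?; rewrite /r; apply/andP; split; lra.
have far m : exists j, cos (theta beta m j) <= cos (2 * pi * d).
  have [j hj] : exists j, forall k : int, e <= `|m%:R * alpha j + k%:~R - beta j|.
    apply: contrapT => /forallNP near_j; apply: no_approx; exists m.
    have : forall j, exists k : int, `|m%:R * alpha j + k%:~R - beta j| < e.
      move=> j; have /existsNP[k /negP] := near_j j; rewrite -ltNge => ?; by exists k.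
    by move=> /choice[k ?]; exists k.
  exists j; apply: cos_far_int; first exact: ltW.
  move=> k; have := hj (- k); rewrite intrN addrAC => h.
  by apply: le_trans h; rewrite ge_min lexx.
have [N Nr] := exp_polynomial_decay n r01.
pose c := 'C(N.*2, N)%:R ^+ n : R.
have kernel_le m : \prod_j (2 + 2 * cos (theta beta m j)) ^+ N <= (4 ^+ N) ^+ n * r ^+ N.
  have [j0 far_j0] := far m.
  rewrite (bigD1 j0)//= [leRHS]mulrC.
  (* The far factor is at most [(4 r) ^ N], each of the other [n - 1] at most [4 ^ N]. *)
  have -> : r ^+ N * (4 ^+ N) ^+ n = (4 * r) ^+ N * (4 ^+ N) ^+ #|[pred j | j != j0]|.
    rewrite cardC1 card_ord (exprMn N 4 r) -[RHS]mulrA [RHS]mulrCA -exprS prednK//.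
    exact: leq_ltn_trans (ltn_ord j0).
  rewrite -prodr_const; apply: ler_pM.
  - by rewrite exprn_ge0//; have := cos_geN1 (theta beta m j0); lra.
  - apply: prodr_ge0 => j _; rewrite exprn_ge0//; have := cos_geN1 (theta beta m j); lra.
  - rewrite lerXn2r// ?nnegrE /r; have := cos_geN1 (theta beta m j0); lra.
  apply: ler_prod => j _.
  have := cos_geN1 (theta beta m j); have := cos_le1 (theta beta m j) => h1 h2.
  by rewrite exprn_ge0 ?lerXn2r ?nnegrE//; lra.
pose w (f : {ffun 'I_n -> 'I_N.*2.+1}) : R[i] :=
  expi (\sum_j 2 * pi * ((f j)%:R - N%:R) * alpha j).
pose cf (f : {ffun 'I_n -> 'I_N.*2.+1}) : R[i] :=
  \prod_j ('C(N.*2, f j)%:R * expi (- (2 * pi * ((f j)%:R - N%:R) * beta j))).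
have ltNN : (N < N.*2.+1)%N by rewrite ltnS -addnn leq_addr.
pose f0 : {ffun 'I_n -> 'I_N.*2.+1} := [ffun=> Ordinal ltNN].
have w_norm f : `|w f| = 1 by exact: norm_expi.
have w0 : w f0 = 1.
  by rewrite /w big1 ?expi0// => j _; rewrite ffunE /= subrr mulr0 mul0r.
(* If [w f = 1], then [\sum_j (f j - N) alpha j] is an integer, and independence forces every
   [f j = N]. *)
have w1 f : f != f0 -> w f != 1.
  apply: contraNN => /eqP; rewrite /w.
  rewrite (_ : \sum_j _ = 2 * pi * \sum_j ((f j)%:Z - N%:Z)%:~R * alpha j); last first.
    by rewrite mulr_sumr; apply: eq_bigr => j _; rewrite intrB !mulrA.
  move=> /expi_eq1[k /Q_indep fN]; apply/eqP/ffunP => j; rewrite ffunE.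
  by apply/val_inj => /=; have /eqP := fN j; rewrite subr_eq0 => /eqP[].
have c0 : cf f0 = c%:C%C.
  rewrite /cf /c rmorphXn /= -[in RHS](card_ord n) -prodr_const.
  apply: eq_bigr => j _; rewrite ffunE /= subrr mulr0 mul0r oppr0 expi0 mulr1.
  by rewrite rmorph_nat.
have [B hB] := exp_sum_mean cf w_norm w0 w1.
have mean M : M%:R * c <= M%:R * ((4 ^+ N) ^+ n * r ^+ N) + B.
  have := hB M; rewrite c0.
  under eq_bigr do rewrite -kernel_expansion.
  rewrite -rmorph_sum /= -(rmorph_nat (real_complex R)) -rmorphM -rmorphB /=.
  rewrite -normrN -rmorphN opprB => h.
  have := le_trans (normc_ge_Re _) h; rewrite lecR /= => /(le_trans (ler_norm _)).
  rewrite lerBlDr => /le_trans; apply.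
  rewrite addrC lerD2r.
  rewrite -[M in leRHS]card_ord mulr_natl -sumr_const.
  by apply: ler_sum => i _.
(* Otherwise the gap times [M] would exceed the fixed [B] for large [M]. *)
have c_le : c <= (4 ^+ N) ^+ n * r ^+ N.
  rewrite leNgt; apply/negP => lt_c.
  have := mean (Num.trunc (B / (c - (4 ^+ N) ^+ n * r ^+ N))).+1.
  rewrite -lerBlDl -mulrBr leNgt -ltr_pdivrMr ?subr_gt0//.
  by rewrite truncnS_gt.
have cp : 0 < c by rewrite exprn_gt0// ltr0n bin_gt0 -addnn leq_addr.
(* Together with [c_le] this gives [c <= (2N + 1) ^ n r ^ N c < c], by the choice of [N]. *)
have : (4 ^+ N) ^+ n <= (N.*2.+1)%:R ^+ n * c.
  rewrite /c -exprMn lerXn2r ?nnegrE// -natrX -natrM ler_nat.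
  exact: central_bin.
move=> /(ler_wpM2r (exprn_ge0 N (proj1 (andP r01)))).
move=> /(le_trans c_le); rewrite mulrAC leNgt; apply/negP/negPn.
by rewrite gtr_pMl.
Qed.

End kronecker.

(** * Resolvents of nonexpansive maps in Hilbert space *)

Section inner_product.
Variables (R : realType) (E : completeNormedModType R) (dot : {dot E for idfun}).
Hypothesis hilbertE : induces_norm dot.
Implicit Types x y z : E.

Lemma dotC x y : dot x y = dot y x.
Proof. by rewrite hermC expr0 mul1r. Qed.

Lemma dotDl x y z : dot (x + y) z = dot x z + dot y z.
Proof. exact: linearDl. Qed.

Lemma dotNl x z : dot (- x) z = - dot x z.
Proof. exact: linearNl. Qed.

Lemma dotZl a x z : dot (a *: x) z = a * dot x z.
Proof. exact: linearZl_LR. Qed.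

Lemma dotDr x y z : dot z (x + y) = dot z x + dot z y.
Proof. by rewrite !(dotC z) dotDl. Qed.

Lemma dotNr x z : dot z (- x) = - dot z x.
Proof. by rewrite !(dotC z) dotNl. Qed.

Lemma dotZr a x z : dot z (a *: x) = a * dot z x.
Proof. by rewrite !(dotC z) dotZl. Qed.

Definition dotE := (dotDl, dotNl, dotZl, dotDr, dotNr, dotZr).

(** Cauchy-Schwarz, obtained by squaring the triangle inequality. *)
Lemma dot_le_norm x y : dot x y <= `|x| * `|y|.
Proof.
have : `|x + y| ^+ 2 <= (`|x| + `|y|) ^+ 2.
  by rewrite lerXn2r ?nnegrE ?addr_ge0// ler_normD.
rewrite sqrrD !hilbertE !dotE (dotC y x) -mulr_natr; lra.
Qed.

(** With [x] and [y] measured from [u], this turns the monotonicity of [I - S] along the resolvent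
    curve into an inequality between norms only. *)
Lemma scaled_monotone_identity (r q : R) x y :
  2 * dot (x - y) (r *: x - q *: y)
  = (r + q) * `|x - y| ^+ 2 + (r - q) * (`|x| ^+ 2 - `|y| ^+ 2).
Proof. by rewrite !hilbertE !dotE (dotC y x); ring. Qed.

(* [\sum_j l j * `|v j - w| ^+ 2 = \sum_j l j * `|v j| ^+ 2 - `|w| ^+ 2] for the
   weighted mean [w]. *)
Lemma convex_comb_extreme n (l : 'I_n -> R) (v : 'I_n -> E) :
  (forall j, 0 < l j) -> \sum_j l j = 1 ->
  (forall j, `|v j| <= `|\sum_i l i *: v i|) ->
  forall j, v j = \sum_i l i *: v i.
Proof.
move=> l0 l1; set w := \sum_i _ => le_w.
have dist2 : \sum_j l j * `|v j - w| ^+ 2 = \sum_j l j * (`|v j| ^+ 2) - `|w| ^+ 2.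
  have -> : `|w| ^+ 2 = 2 * dot w w - (\sum_j l j) * `|w| ^+ 2.
    by rewrite l1 hilbertE; ring.
  rewrite [in dot w]/w linear_sumlz /=.
  rewrite mulr_sumr mulr_suml opprB addrCA -sumrB -big_split /=.
  apply: eq_bigr => j _; rewrite !hilbertE !dotE (dotC w); ring.
have le0 : \sum_j l j * `|v j - w| ^+ 2 <= 0.
  rewrite dist2 subr_le0 -[leRHS]mul1r -l1 mulr_suml.
  apply: ler_sum => j _; rewrite ler_pM2l//.
  by rewrite lerXn2r ?nnegrE.
move=> j; apply/eqP; rewrite -subr_eq0 -normr_eq0 -sqrf_eq0.
have pos i : true -> 0 <= l i * `|v i - w| ^+ 2.
  by rewrite mulr_ge0 ?exprn_ge0// ltW.
have /eqP : \sum_j l j * `|v j - w| ^+ 2 = 0.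
  by apply/eqP; rewrite eq_le le0 sumr_ge0.
rewrite psumr_eq0// => /allP/(_ j); rewrite mem_index_enum => /(_ isT) /=.
by rewrite mulf_eq0 gt_eqF.
Qed.

End inner_product.

(** * Finite convex combinations *)

Section convexity.
Variables (R : realType) (E : normedModType R) (C : set E).
Hypothesis C_convex : convex_set C.

Lemma convex_comb2 a (x y : E) : 0 <= a <= 1 -> C x -> C y ->
  C ((1 - a) *: x + a *: y).
Proof.
move=> /andP[a0 a1] Cx Cy.
have := @C_convex y x (Itv01 a0 a1); rewrite !inE => /(_ Cy Cx).
by rewrite /conv /= addrC.
Qed.

(** Peel off the first weight and renormalise the others; their sum [1 - l ord0] is nonzero because
    all weights are positive. *)
Lemma convex_comb n (l : 'I_n.+1 -> R) (x : 'I_n.+1 -> E) :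
  (forall j, 0 < l j) -> \sum_j l j = 1 -> (forall j, C (x j)) ->
  C (\sum_j l j *: x j).
Proof.
elim: n l x => [|n IH] l x l0 l1 Cx.
  by move: l1; rewrite !big_ord1 => ->; rewrite scale1r.
have l1' : \sum_(j < n.+1) l (lift ord0 j) = 1 - l ord0.
  by rewrite -l1 [in RHS]big_ord_recl addrAC subrr add0r.
have pos : 0 < 1 - l ord0.
  rewrite -l1' big_ord_recl ltr_pwDl// sumr_ge0// => j _; exact: ltW.
rewrite big_ord_recl /=.
have -> : \sum_(i < n.+1) l (lift ord0 i) *: x (lift ord0 i)
  = (1 - l ord0) *: \sum_(i < n.+1)
      (l (lift ord0 i) / (1 - l ord0)) *: x (lift ord0 i).
  rewrite scaler_sumr; apply: eq_bigr => i _.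
  by rewrite scalerA mulrCA divff ?mulr1// gt_eqF.
rewrite addrC; apply: convex_comb2 => //.
  by rewrite ltW//= -subr_ge0 ltW.
apply: IH => //= [j|]; first by rewrite divr_gt0.
by rewrite -mulr_suml l1' divff// gt_eqF.
Qed.

End convexity.

Lemma cauchy_seq_cvg (R : realType) (E : completeNormedModType R) (x : nat -> E) :
  (forall e : R, 0 < e -> \forall k \near \oo, \forall l \near \oo, `|x k - x l| < e) ->
  cvgn x.
Proof.
move=> x_cauchy; apply/cauchy_cvgP; apply/cauchyP => e e0.
near \oo => k; exists (x k).
have : \forall l \near \oo, `|x k - x l| < e by near: k; exact: x_cauchy.
by rewrite -ball_normE.
Unshelve. all: end_near. Qed.

(** * The resolvent curve and its limit *)

Section resolvent.
Variables (R : realType) (E : completeNormedModType R) (dot : {dot E for idfun}).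
Hypothesis hilbertE : induces_norm dot.
Variables (C : set E) (C_closed : closed C) (C_convex : convex_set C).
Variables (D : R) (C_diam : forall x y, C x -> C y -> `|x - y| <= D).
Variables (S : E -> E) (S_into : forall x, C x -> C (S x)).
Hypothesis S_nonexp : nonexpansive_on C S.
Variables (u : E) (Cu : C u).
Implicit Types (s t : R) (x y : E).

(** For [s > 0] the equation reads [x + ((1 - s) / s) (x - S x) = u]: [x] is a resolvent of the
    monotone map [I - S] at [u]. *)
Definition resolvent_eq s x := C x /\ x = (1 - s) *: S x + s *: u.

Lemma diam_ge0 : 0 <= D.
Proof. by apply: le_trans (C_diam Cu Cu). Qed.

(** Banach's fixed point theorem for a contraction of ratio [1 - s]. *)
Lemma resolvent_ex s : 0 < s < 1 -> exists! x, resolvent_eq s x.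
Proof.
move=> /andP[s0 s1].
have q0 : 0 <= 1 - s by rewrite subr_ge0 ltW.
pose f x := (1 - s) *: S x + s *: u.
have f_into : {homo f : x / C x >-> C x}.
  by move=> x Cx; apply: convex_comb2 => //; [rewrite !ltW|exact: S_into].
have f_contr x y : C x -> C y -> `|f x - f y| <= (1 - s) * `|x - y|.
  move=> Cx Cy; rewrite /f opprD addrACA subrr addr0 -scalerBr normrZ.
  by rewrite ger0_norm// ler_wpM2l// S_nonexp.
pose g := mkfun_fun f_into.
have g_contr : is_contraction g.
  exists (NngNum q0); split => /=; first by rewrite ltrBlDr ltrDl.
  by move=> [x y] /= [Cx Cy]; exact: f_contr.
have C0 : C !=set0 by exists u.
have [x Cx fx] := banach_fixed_point g_contr C_closed C0.
exists x; split; first by split.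
by move=> y [Cy fy]; exact: (contraction_fixpoint_unique g_contr Cx Cy fx fy).
Qed.

Lemma id_sub_nonexp_monotone x y : C x -> C y ->
  0 <= dot (x - y) ((x - S x) - (y - S y)).
Proof.
move=> Cx Cy.
have -> : (x - S x) - (y - S y) = (x - y) - (S x - S y).
  by rewrite !opprB [S y - y]addrC addrACA [- S x + _]addrC.
rewrite dotDr dotNr -hilbertE subr_ge0.
apply: (le_trans (dot_le_norm hilbertE _ _)).
by rewrite expr2 ler_wpM2l// S_nonexp.
Qed.

Lemma resolvent_residual s x : s < 1 -> resolvent_eq s x ->
  x - S x = - (s / (1 - s)) *: (x - u).
Proof.
move=> s1 [_ xE]; have nz : 1 - s != 0 by rewrite subr_eq0 gt_eqF.
apply: (@scalerI _ _ (1 - s)) => //.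
rewrite scalerA mulrN mulrCA divff// mulr1 scalerBr.
rewrite (_ : (1 - s) *: S x = x - s *: u); last by rewrite [in RHS]xE addrK.
by rewrite scalerBl scale1r scaleNr scalerBr !opprB addrC addrA subrK.
Qed.

Let rate s := s / (1 - s).

Let rate_gt0 s : 0 < s < 1 -> 0 < rate s.
Proof. by move=> /andP[s0 s1]; rewrite divr_gt0// subr_gt0. Qed.

Lemma resolvent_dist s t x y : 0 < s < 1 -> 0 < t < 1 ->
  resolvent_eq s x -> resolvent_eq t y ->
  (rate s + rate t) * `|x - y| ^+ 2
  + (rate s - rate t) * (`|x - u| ^+ 2 - `|y - u| ^+ 2) <= 0.
Proof.
move=> /andP[s0 s1] /andP[t0 t1] hx hy.
have := id_sub_nonexp_monotone hx.1 hy.1.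
rewrite (resolvent_residual s1 hx) (resolvent_residual t1 hy).
rewrite -/(rate s) -/(rate t).
have xyE : x - y = (x - u) - (y - u) by rewrite opprB addrA subrK.
rewrite xyE -(scaled_monotone_identity hilbertE).
set a := x - u; set b := y - u; rewrite !dotE; lra.
Qed.

(** In [resolvent_dist] the rates are positive, so the absolute value of [rate s - rate t] is at
    most [rate s + rate t], which cancels. *)
Lemma resolvent_dist_le s t x y : 0 < s < 1 -> 0 < t < 1 ->
  resolvent_eq s x -> resolvent_eq t y ->
  `|x - y| ^+ 2 <= `| `|x - u| ^+ 2 - `|y - u| ^+ 2|.
Proof.
move=> s01 t01 hx hy; have := resolvent_dist s01 t01 hx hy.
have := rate_gt0 s01; have := rate_gt0 t01.
set q := rate t; set r := rate s; set d := _ - _ ^+ 2 => q0 r0 h.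
have r1 := ler_norm d; have r2 := ler_norm (- d); rewrite normrN in r2.
have d0 := normr_ge0 d.
set X := `|x - y| ^+ 2 in h *; set Z := `|d| in r1 r2 d0 *.
rewrite leNgt; apply/negP => ZX.
have : (r + q) * Z < (r + q) * X by rewrite ltr_pM2l// addr_gt0.
have : - (r + q) * Z <= (r - q) * d.
  have := mulr_ge0 (ltW r0) (_ : 0 <= d + Z); have := mulr_ge0 (ltW q0) (_ : 0 <= Z - d).
  move=> /(_ ltac:(lra)) h1 /(_ ltac:(lra)) h2; lra.
lra.
Qed.

(** Since [rate] is increasing, the second term of [resolvent_dist] has a positive coefficient, and
    the first term is nonnegative. *)
Lemma resolvent_dist_anti s t x y : 0 < s < 1 -> 0 < t < 1 -> t < s ->
  resolvent_eq s x -> resolvent_eq t y -> `|x - u| ^+ 2 <= `|y - u| ^+ 2.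
Proof.
move=> s01 t01 ts hx hy; have := resolvent_dist s01 t01 hx hy.
have := rate_gt0 s01; have := rate_gt0 t01.
have : rate t < rate s.
  case/andP: s01 => s0 s1; case/andP: t01 => t0 t1.
  rewrite /rate ltr_pdivrMr ?subr_gt0// mulrAC ltr_pdivlMr ?subr_gt0//; nra.
set q := rate t; set r := rate s => qr q0 r0 h.
rewrite -subr_le0 -(pmulr_rle0 _ (_ : 0 < r - q)) ?subr_gt0//.
have : 0 <= (r + q) * `|x - y| ^+ 2.
  by apply: mulr_ge0; [rewrite ltW ?addr_gt0|rewrite exprn_ge0].
lra.
Qed.

(* [`|x k - u|] is nonincreasing in [s k] and bounded, so [resolvent_dist_le]
   makes [x] Cauchy: no weak compactness is involved.  The last clause is the
   variational inequality for [z], in a form valid for approximate fixed points. *)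
Lemma resolvent_limit (s : nat -> R) (x : nat -> E) :
  (forall k, 0 < s k < 1) -> s @ \oo --> (0 : R) ->
  (forall k, resolvent_eq (s k) (x k)) ->
  exists z, [/\ C z, x @ \oo --> z, S z = z &
    forall e, 0 < e -> exists2 d, 0 < d &
      forall y, C y -> `|y - S y| <= d -> dot (z - y) (z - u) <= e].
Proof.
move=> s01 s_cvg0 hx.
pose g k := `|x k - u| ^+ 2.
have g_ub k : g k <= D ^+ 2.
  by rewrite lerXn2r ?nnegrE ?diam_ge0// C_diam//; exact: (hx k).1.
have g_sup : has_sup (range g).
  split; first by exists (g 0%N); exists 0%N.
  by exists (D ^+ 2) => _ [k _ <-].
have : cvgn x.
  apply: cauchy_seq_cvg => e e0.
  have e2 : 0 < e ^+ 2 by rewrite exprn_gt0.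
  have [_ [K _ <-] gK] := sup_adherent e2 g_sup.
  (* [s] need not be monotone, but eventually [s k < s K], whence [g k >= g K]. *)
  have near_sup : \forall k \near \oo, sup (range g) - e ^+ 2 < g k <= sup (range g).
    have sK0 : 0 < s K by case/andP: (s01 K).
    near=> k; apply/andP; split; last by apply: sup_upper_bound => //; exists k.
    apply: (lt_le_trans gK).
    apply: (resolvent_dist_anti (s01 K) (s01 k) _ (hx K) (hx k)).
    by near: k; exact: (cvgr_lt 0).
  near=> k; near=> l.
  rewrite -(@ltr_pXn2r _ 2) ?nnegrE// 1?ltW//.
  apply: (le_lt_trans (resolvent_dist_le (s01 k) (s01 l) (hx k) (hx l))).
  have /andP[k1 k2] : sup (range g) - e ^+ 2 < g k <= sup (range g).
    by near: k.
  have /andP[l1 l2] : sup (range g) - e ^+ 2 < g l <= sup (range g).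
    by near: l.
  by rewrite -/(g k) -/(g l) ltr_norml; apply/andP; split; lra.
move=> /cvg_ex[z xz]; exists z.
have Cz : C z.
  by apply: (closed_cvg _ C_closed _ _ xz); apply: nearW => k; exact: (hx k).1.
have near_z e : 0 < e -> \forall k \near \oo, `|z - x k| < e.
  by move=> e0; move/cvgrPdist_lt : xz; exact.
split => //.
  apply/eqP; rewrite -subr_eq0 -normr_le0; apply/ler_addgt0Pr => e e0; rewrite add0r.
  near \oo => k.
  have Cxk := (hx k).1.
  have h1 : `|z - x k| < e / 3 by near: k; apply: near_z; rewrite divr_gt0.
  (* [D] may be zero, so divisions use [D + 1]. *)
  have h2 : s k * (D + 1) < e / 3.
    rewrite -ltr_pdivlMr; last by rewrite ltr_wpDl ?diam_ge0.
    near: k; apply: (cvgr_lt 0) => //.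
    by rewrite !divr_gt0// ltr_wpDl ?diam_ge0.
  have h3 : `|x k - S (x k)| <= s k * (D + 1).
    rewrite {1}(hx k).2 scalerBl scale1r addrAC [S _ - _]addrC addrK addrC.
    rewrite -scalerBr normrZ ger0_norm; last by case/andP: (s01 k) => /ltW.
    rewrite ler_wpM2l//; first by case/andP: (s01 k) => /ltW.
    by apply: (le_trans (C_diam Cu (S_into Cxk))); rewrite lerDl.
  have h4 : `|S (x k) - S z| <= `|x k - z| by exact: S_nonexp.
  have a1 : `|S z - z| <= `|S z - S (x k)| + `|S (x k) - z| by exact: ler_distD.
  have a2 : `|S (x k) - z| <= `|S (x k) - x k| + `|x k - z| by exact: ler_distD.
  rewrite distrC in h1; rewrite distrC in h3.
  rewrite (distrC (S z) (S (x k))) in a1; lra.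
move=> e e0.
near \oo => k.
have Cxk := (hx k).1.
have h1 : `|z - x k| * D <= e / 3.
  apply: (@le_trans _ _ (`|z - x k| * (D + 1))).
    by rewrite ler_wpM2l// lerDl.
  rewrite -ler_pdivlMr; last by rewrite ltr_wpDl ?diam_ge0.
  apply: ltW; near: k; apply: near_z.
  by rewrite !divr_gt0// ltr_wpDl ?diam_ge0.
have D1 : 0 < D + 1 by rewrite ltr_wpDl ?diam_ge0.
have r0 := rate_gt0 (s01 k).
(* Monotonicity bounds [rate (s k)] times the product in [step] by [(D + 1)] times the residual of
   [y]; this [d] makes that at most [rate (s k) * (e / 3)]. *)
exists (rate (s k) * (e / 3) / (D + 1)); first by rewrite divr_gt0// mulr_gt0// divr_gt0.
move=> y Cy yd.
have step : dot (x k - y) (x k - u) <= e / 3.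
  have := id_sub_nonexp_monotone Cxk Cy.
  rewrite (resolvent_residual _ (hx k)); last by case/andP: (s01 k).
  rewrite -/(rate (s k)) dotDr dotZr mulNr dotNr.
  have := dot_le_norm hilbertE (y - x k) (y - S y).
  rewrite -(opprB (x k) y) dotNl => h2 h3.
  have h4 : `| - (x k - y)| * `|y - S y| <= (D + 1) * `|y - S y|.
    rewrite ler_wpM2r// normrN; apply: (le_trans (C_diam Cxk Cy)).
    by rewrite lerDl.
  have h5 : (D + 1) * `|y - S y| <= rate (s k) * (e / 3).
    by rewrite mulrC -ler_pdivlMr.
  rewrite -(ler_pM2l r0); lra.
(* Replacing [z] by [x k] costs two terms, each at most the distance from [z] to [x k] times [D]. *)
have -> : dot (z - y) (z - u)
  = dot (z - x k) (z - u) + dot (z - x k) (x k - y) + dot (x k - y) (x k - u).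
  by rewrite !dotE (dotC dot y z) (dotC dot y (x k)) (dotC dot z (x k)); ring.
have b1 : dot (z - x k) (z - u) <= e / 3.
  apply: (le_trans (dot_le_norm hilbertE _ _)); apply: le_trans h1.
  by rewrite ler_wpM2l// C_diam.
have b2 : dot (z - x k) (x k - y) <= e / 3.
  apply: (le_trans (dot_le_norm hilbertE _ _)); apply: le_trans h1.
  by rewrite ler_wpM2l// C_diam.
lra.
Unshelve. all: end_near. Qed.

Lemma nonexpansive_fixpoint : exists2 z, C z & S z = z.
Proof.
(* The shift by two keeps [s 0] below 1. *)
pose s k : R := k.+2%:R^-1.
have s01 k : 0 < s k < 1 by rewrite invr_gt0 ltr0n invf_lt1 ?ltr1n ?ltr0n.
have s_cvg0 : s @ \oo --> (0 : R).
  by have := @cvg_harmonic R; rewrite -cvg_shiftS.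
have /choice[x hx] : forall k, exists x, resolvent_eq (s k) x.
  by move=> k; have [x [hx _]] := resolvent_ex (s01 k); exists x.
by have [z [Cz _ Sz _]] := resolvent_limit s01 s_cvg0 hx; exists z.
Qed.

End resolvent.

(** * Common fixed points of commuting nonexpansive maps *)

Section fixed_points.
Variables (R : realType) (E : completeNormedModType R) (dot : {dot E for idfun}).
Hypothesis hilbertE : induces_norm dot.

Lemma bounded_diam (C : set E) : bounded_set C ->
  exists D : R, forall x y, C x -> C y -> `|x - y| <= D.
Proof.
move=> [M [_ hM]]; have hM1 := hM (M + 1) (ltr_pwDr ltr01 (lexx M)).
exists ((M + 1) + (M + 1)) => x y Cx Cy.
by rewrite (le_trans (ler_normB _ _))// lerD// hM1.
Qed.

Lemma closed_fixpoints (C : set E) (f : E -> E) : closed C ->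
  nonexpansive_on C f -> closed [set x | C x /\ f x = x].
Proof.
move=> Ccl fne x clx.
have Cx : C x by apply: Ccl => B /clx[y [[Cy _] By]]; exists y.
split => //; apply/eqP; rewrite -subr_eq0 -normr_le0.
apply/ler_addgt0Pr => e e0; rewrite add0r.
have e2 : 0 < e / 2 by rewrite divr_gt0.
have [y [[Cy fy]]] := clx _ (nbhsx_ballx x _ e2).
rewrite -ball_normE /= => xy.
have := ler_distD y (f x) x; have := fne _ _ Cx Cy; rewrite fy (distrC y x).
lra.
Qed.

(** For [z] between fixed points [x] and [y], [f z] is no farther from either than [z] is; Stewart's
    identity then forces [f z = z]. *)
Lemma convex_fixpoints (C : set E) (f : E -> E) : convex_set C ->
  nonexpansive_on C f -> convex_set [set x | C x /\ f x = x].
Proof.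
move=> Ccv fne x y l; rewrite !inE => -[Cx fx] [Cy fy].
have Cz : C (conv l x y).
  by have := Ccv x y l; rewrite !inE; exact.
split => //; set z := conv l x y in Cz *.
have l0 : 0 <= l%:num by [].
have l1 : l%:num <= 1 by [].
have zE : z = l%:num *: x + (1 - l%:num) *: y by [].
clearbody z.
have dx : `|f z - x| <= (1 - l%:num) * `|x - y|.
  rewrite -{1}fx (le_trans (fne _ _ Cz Cx))// zE.
  rewrite (_ : _ - x = (1 - l%:num) *: (y - x)); last first.
    by rewrite scalerBr [_ *: x in RHS]scalerBl scale1r opprB addrCA addrA.
  by rewrite normrZ ger0_norm ?subr_ge0// distrC.
have dy : `|f z - y| <= l%:num * `|x - y|.
  rewrite -{1}fy (le_trans (fne _ _ Cz Cy))// zE.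
  rewrite (_ : _ - y = l%:num *: (x - y)); last first.
    by rewrite scalerBr scalerBl scale1r -!addrA; congr (_ + _); rewrite addrCA subrr addr0.
  by rewrite normrZ ger0_norm.
suff : `|f z - z| ^+ 2 <= 0.
  move=> le0; apply/eqP.
  by rewrite -subr_eq0 -normr_eq0 -sqrf_eq0 eq_le le0 exprn_ge0.
have -> : `|f z - z| ^+ 2 = l%:num * `|f z - x| ^+ 2 + (1 - l%:num) * `|f z - y| ^+ 2
   - l%:num * (1 - l%:num) * `|x - y| ^+ 2.
  rewrite {2}zE !hilbertE !dotE !(dotC dot _ (f z)) (dotC dot y x); ring.
have h1 : `|f z - x| ^+ 2 <= ((1 - l%:num) * `|x - y|) ^+ 2.
  by rewrite lerXn2r ?nnegrE ?mulr_ge0 ?subr_ge0.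
have h2 : `|f z - y| ^+ 2 <= (l%:num * `|x - y|) ^+ 2.
  by rewrite lerXn2r ?nnegrE ?mulr_ge0.
have := ler_wpM2l l0 h1; have l1' : 0 <= 1 - l%:num by rewrite subr_ge0.
have := ler_wpM2l l1' h2; rewrite !exprMn; set X := `|x - y| ^+ 2; lra.
Qed.

(** Induction on the list: the fixed points of the first map form a nonempty closed convex set,
    which the other maps preserve because they commute with it. *)
Lemma commuting_common_fixpoint (I : eqType) (fs : seq I) (f : I -> E -> E) (C : set E) :
  C !=set0 -> bounded_set C -> closed C -> convex_set C ->
  (forall i x, C x -> C (f i x)) -> (forall i, nonexpansive_on C (f i)) ->
  (forall i j x, C x -> f i (f j x) = f j (f i x)) ->
  exists2 z, C z & {in fs, forall i, f i z = z}.
Proof.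
elim: fs C => [|i fs IH] C [u Cu] Cb Ccl Ccv f_into fne fcomm.
  by exists u.
have [D CD] := bounded_diam Cb.
have [w Cw fw] := nonexpansive_fixpoint hilbertE Ccl Ccv CD (f_into i) (fne i) Cu.
have [|||||||z [Cz fz] Hz] := IH [set x | C x /\ f i x = x].
- by exists w.
- by case: Cb => M [Mreal hM]; exists M; split=> // N MN x [Cx _]; exact: hM.
- exact: closed_fixpoints.
- exact: convex_fixpoints.
- by move=> j x [Cx fx]; split; [exact: f_into|rewrite fcomm// fx].
- by move=> j x y [Cx _] [Cy _]; exact: fne.
- by move=> j k x [Cx _]; exact: fcomm.
by exists z => // j; rewrite in_cons => /predU1P[->|/Hz].
Qed.

End fixed_points.

(** * Halpern's iteration *)

Section real_recursion.
Variable R : realType.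

(** Unroll the recursion from an index [N] past which [c] and the tails of [b] are small; the
    factors [1 - t k <= expR (- t k)] multiply to a quantity tending to 0 because the sum of [t]
    diverges. *)
Lemma contracting_recursion (a t b c : nat -> R) :
  (forall k, 0 <= a k) -> (forall k, 0 <= t k <= 1) -> (forall k, 0 <= b k) ->
  (forall A, exists N, A <= \sum_(0 <= k < N) t k) ->
  (forall e, 0 < e -> exists N, forall M, \sum_(N <= k < M) b k <= e) ->
  (forall e, 0 < e -> \forall k \near \oo, c k <= e) ->
  (forall k, a k.+1 <= (1 - t k) * a k + t k * c k + b k) ->
  a @ \oo --> (0 : R).
Proof.
move=> a0 t01 b0 t_sum b_sum c_le rec; apply/cvgrPdist_le => e e0.
have e3 : 0 < e / 3 by rewrite divr_gt0.
have [N1 hb] := b_sum _ e3.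
have [N2 _ hc] := c_le _ e3.
pose N := maxn N1 N2.
have hbN M : \sum_(N <= k < M) b k <= e / 3.
  have [NM|MN] := leqP N M; last by rewrite big_geq ?ltW// ltnW.
  apply: le_trans (hb M); rewrite [leRHS](big_cat_nat (n := N)) ?leq_maxl//=.
  by rewrite lerDr sumr_ge0.
have bound m : a (N + m)%N <= e / 3 + \sum_(N <= k < N + m) b k
    + expR (- \sum_(N <= k < N + m) t k) * a N.
  elim: m => [|m IH].
    by rewrite addn0 !big_geq// oppr0 expR0 mul1r addr0 lerDr ltW.
  rewrite addnS !big_nat_recr ?leq_addr//=.
  set k := (N + m)%N in IH *; set B := \sum_(_ <= _ < _) b _ in IH *.
  set X := \sum_(_ <= _ < _) t _ in IH *.
  have ck : c k <= e / 3 by apply: hc => /=; rewrite /k (leq_trans (leq_maxr N1 N2)) ?leq_addr.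
  have /andP[tk0 tk1] := t01 k.
  have B0 : 0 <= B by rewrite /B sumr_ge0.
  have tk1' : 0 <= 1 - t k by rewrite subr_ge0.
  have ex : 1 - t k <= expR (- t k) by rewrite expR_ge1Dx.
  rewrite opprD expRD.
  have := rec k; have := ler_wpM2l tk1' IH; have := ler_wpM2l tk0 ck.
  have P0 : 0 <= expR (- X) * a N by rewrite mulr_ge0 ?expR_ge0.
  have := ler_wpM2r P0 ex; have := mulr_ge0 tk0 B0.
  rewrite mulrAC; set P := expR (- X) * a N in P0 *; set Q := expR (- t k); rewrite -/P.
  have -> : expR (- X) * a N * Q = Q * P by rewrite /P mulrC.
  lra.
(* Past [L] the sum [X] of [t] from [N] is at least [a N / (e / 3)], and [expR X >= 1 + X] makes the
   last term of [bound] at most [e / 3]. *)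
have [L hL] := t_sum (\sum_(0 <= k < N) t k + a N / (e / 3)).
near=> k.
have Nk : (maxn N L <= k)%N by near: k; exact: nbhs_infty_ge.
have [NK LK] : (N <= k)%N /\ (L <= k)%N by move: Nk; rewrite geq_max => /andP.
rewrite sub0r normrN ger0_norm//.
have := bound (k - N)%N; rewrite subnKC// => /le_trans; apply.
have := hbN k; set X := \sum_(_ <= _ < _) t _.
have hX : a N / (e / 3) <= X.
  rewrite -(lerD2l (\sum_(0 <= k < N) t k)) (le_trans hL)//.
  rewrite -big_cat_nat//= [leRHS](big_cat_nat (n := L))//= lerDl sumr_ge0// => i _.
  by case/andP: (t01 i).
have : expR (- X) * a N <= e / 3.
  rewrite expRN mulrC ler_pdivrMr ?expR_gt0//.
  rewrite mulrC -ler_pdivrMr// (le_trans hX)//.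
  by rewrite (le_trans _ (expR_ge1Dx X))// lerDr.
lra.
Unshelve. all: end_near. Qed.

Lemma diverging_partial_sums (t : nat -> R) : (forall k, 0 <= t k) ->
  (\sum_(0 <= k <oo) (t k)%:E = +oo)%E ->
  forall A, exists N, A <= \sum_(0 <= k < N) t k.
Proof.
move=> t0 t_sum A; apply: contrapT => /forallNP lt_A.
suff : (+oo <= A%:E)%E by rewrite leNgt ltry.
rewrite -t_sum; apply: lime_le.
  by apply: is_cvg_nneseries => k _ _; rewrite lee_fin.
apply: nearW => N; rewrite sumEFin lee_fin.
by apply: ltW; rewrite ltNge; apply/negP.
Qed.

Lemma summable_tails (b : nat -> R) : (forall k, 0 <= b k) ->
  (\sum_(0 <= k <oo) (b k)%:E < +oo)%E ->
  forall e, 0 < e -> exists N, forall M, \sum_(N <= k < M) b k <= e.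
Proof.
move=> b0 b_sum e e0.
have tail_cvg := nneseries_tail_cvg (P := xpredT) b_sum (fun k _ => b0 k).
near \oo => N; exists N => M; rewrite -lee_fin -sumEFin.
apply: le_trans (_ : \sum_(N <= k <oo) (b k)%:E <= e%:E)%E.
  by apply: nneseries_lim_ge => k _ _; rewrite lee_fin.
have tail_fin : (\sum_(N <= k <oo) (b k)%:E)%E \is a fin_num.
  by near: N; exact: cvg_is_fine tail_cvg.
rewrite -(fineK tail_fin) lee_fin (le_trans (ler_norm _))//.
rewrite -normrN -sub0r; near: N.
by move: tail_cvg => /fine_cvg /cvgrPdist_le; exact.
Unshelve. all: end_near. Qed.


End real_recursion.

Section halpern_iteration.
Variables (R : realType) (E : completeNormedModType R) (dot : {dot E for idfun}).
Hypothesis hilbertE : induces_norm dot.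
Variables (C : set E) (C_bounded : bounded_set C) (C_convex : convex_set C).
Variables (S : E -> E) (S_into : forall x, C x -> C (S x)).
Hypothesis S_nonexp : nonexpansive_on C S.
Variables (u : E) (Cu : C u).

(** [contracting_recursion] is applied twice: to the steps of [y], which makes the residuals vanish,
    and then to the squared distance to [z], where the variational inequality [z_var] controls the
    forcing term. *)
Lemma halpern_cvg (z : E) (t : nat -> R) (y : nat -> E) :
  C z -> S z = z ->
  (forall e, 0 < e -> exists2 d, 0 < d &
    forall y, C y -> `|y - S y| <= d -> dot (z - y) (z - u) <= e) ->
  (forall k, 0 < t k < 1) -> t @ \oo --> (0 : R) ->
  (\sum_(0 <= k <oo) (t k)%:E = +oo)%E ->
  (\sum_(0 <= k <oo) (`|t k.+1 - t k|)%:E < +oo)%E ->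
  C (y 0%N) -> (forall k, y k.+1 = (1 - t k) *: S (y k) + t k *: u) ->
  y @ \oo --> z.
Proof.
move=> Cz Sz z_var t01 t_cvg0 t_sum t_var Cy0 yE.
have [D C_diam] := bounded_diam C_bounded.
have D0 : 0 <= D by apply: le_trans (C_diam u u Cu Cu).
have t0 k : 0 <= t k by case/andP: (t01 k) => /ltW.
have t01' k : 0 <= t k <= 1 by rewrite !ltW//; case/andP: (t01 k).
have Cy k : C (y k).
  by elim: k => // k IH; rewrite yE; apply: convex_comb2 => //; exact: S_into.
have t_div := diverging_partial_sums t0 t_sum.
have steps_cvg0 : (fun k => `|y k.+1 - y k|) @ \oo --> (0 : R).
  apply: (@contracting_recursion _ _ (fun k => t k.+1)
    (fun k => D * `|t k.+1 - t k|) (fun=> 0)) => //.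
  - by move=> k; rewrite mulr_ge0.
  (* The shifted series lacks [t 0], which is added to the target in advance. *)
  - move=> A; have [N hN] := t_div (A + t 0%N); exists N.
    have : \sum_(0 <= k < N) t k <= \sum_(0 <= k < N.+1) t k.
      by rewrite big_nat_recr//= lerDl.
    rewrite big_nat_recl//; lra.
  - move=> e e0; have D1 : 0 < D + 1 by rewrite ltr_wpDl.
    have [N hN] := summable_tails (fun k => normr_ge0 (t k.+1 - t k)) t_var (divr_gt0 e0 D1).
    exists N => M; rewrite -mulr_sumr.
    have := hN M; rewrite ler_pdivlMr// mulrC; apply: le_trans.
    by rewrite ler_wpM2r ?sumr_ge0// lerDl.
  - by move=> e e0; apply: nearW => _; exact: ltW.
  move=> k; rewrite mulr0 addr0.
  have -> : y k.+2 - y k.+1 = (1 - t k.+1) *: (S (y k.+1) - S (y k))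
      + (t k.+1 - t k) *: (u - S (y k)).
    rewrite [y k.+2]yE {2}[y k.+1]yE.
    rewrite -(subrKA ((1 - t k.+1) *: S (y k) + t k.+1 *: u)); congr (_ + _).
      by rewrite opprD addrACA subrr addr0 -scalerBr.
    rewrite opprD addrACA -!scalerBl scalerBr addrC; congr (_ + _).
    by rewrite -scaleNr; congr (_ *: _); ring.
  apply: (le_trans (ler_normD _ _)); rewrite !normrZ.
  rewrite ger0_norm ?subr_ge0; last by case/andP: (t01' k.+1).
  apply: lerD; first by rewrite ler_wpM2l ?S_nonexp// subr_ge0; case/andP: (t01' k.+1).
  by rewrite mulrC ler_wpM2r// C_diam//; exact: S_into.
have residual_cvg0 e : 0 < e -> \forall k \near \oo, `|y k - S (y k)| <= e.
  move=> e0; have D1 : 0 < D + 1 by rewrite ltr_wpDl.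
  near=> k.
  have h1 : `|y k.+1 - y k| < e / 2.
    by near: k; apply: (cvgr_lt 0) => //; rewrite divr_gt0.
  have h2 : t k * (D + 1) < e / 2.
    by rewrite -ltr_pdivlMr//; near: k; apply: (cvgr_lt 0) => //; rewrite !divr_gt0.
  have h3 : `|y k.+1 - S (y k)| <= t k * (D + 1).
    have -> : y k.+1 - S (y k) = t k *: (u - S (y k)).
      by rewrite yE scalerBl scale1r scalerBr addrAC [S _ - _]addrC addrK addrC.
    rewrite normrZ ger0_norm// ler_wpM2l//.
    by rewrite (le_trans (C_diam _ _ Cu (S_into (Cy k))))// lerDl.
  have := ler_distD (y k.+1) (y k) (S (y k)); rewrite (distrC (y k) (y k.+1)); lra.
have : (fun k => `|y k - z| ^+ 2) @ \oo --> (0 : R).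
  apply: (@contracting_recursion _ _ t (fun=> 0)
     (fun k => 2 * dot (u - z) (y k.+1 - z))) => //.
  - by move=> e e0; exists 0%N => M; rewrite big1 ?ltW.
  - move=> e e0; have e2 : 0 < e / 2 by rewrite divr_gt0.
    have [d d0 hd] := z_var _ e2.
    have [N _ hN] := residual_cvg0 _ d0.
    exists N => // k /= Nk; have := hd _ (Cy k.+1) (hN k.+1 (leqW Nk)).
    rewrite dotC -(opprB u z) -(opprB (y k.+1) z) dotNl dotNr opprK; lra.
  move=> k; rewrite addr0.
  (* With [a] and [b] as below, the square of the norm is [(1 - t)^2 |a|^2 + 2 t <b, y k.+1 - z> -
     t^2 |b|^2]; the last term is dropped. *)
  have -> : y k.+1 - z = (1 - t k) *: (S (y k) - z) + t k *: (u - z).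
    rewrite yE !scalerBr addrACA -opprD -scalerDl subrK scale1r //.
  set a := S (y k) - z; set b := u - z.
  have le_a : `|a| ^+ 2 <= `|y k - z| ^+ 2.
    by rewrite lerXn2r ?nnegrE// /a -{1}Sz S_nonexp.
  have /andP[tk0 tk1] := t01' k.
  have sq0 : 0 <= t k ^+ 2 * `|b| ^+ 2 by rewrite mulr_ge0 ?exprn_ge0.
  have : (1 - t k) ^+ 2 * `|a| ^+ 2 <= (1 - t k) * `|y k - z| ^+ 2.
    rewrite expr2 -mulrA ler_wpM2l ?subr_ge0//.
    by apply: le_trans le_a; rewrite ler_piMl ?exprn_ge0// lerBlDr lerDl.
  clearbody a b; move: sq0; rewrite !hilbertE !dotE (dotC dot b a) => ? ?; lra.
move=> y2; apply/cvgrPdist_lt => e e0; near=> k.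
rewrite distrC -(@ltr_pXn2r _ 2) ?nnegrE// 1?ltW//.
by near: k; apply: (cvgr_lt 0) => //; rewrite exprn_gt0.
Unshelve. all: end_near. Qed.

End halpern_iteration.

(** * Semigroups over the orthant *)

Section semigroup.
Variables (R : realType) (n : nat).
Variables (p : 'I_n.+1 -> 'rV[R]_n) (alpha : 'I_n -> R).
Hypothesis p_ge0 : forall j, nonneg_orthant R n (p j).
Hypothesis p_free : free [tuple p (lift ord0 i) | i < n].
Hypothesis alpha_indep :
  linearly_independent_over_Q [tuple of 1 :: [tuple alpha i | i < n]].
Hypothesis p0E : p ord0 = \sum_(i < n) alpha i *: p (lift ord0 i).

Lemma free_span_row (v : 'rV[R]_n) :
  exists beta : 'I_n -> R, v = \sum_i beta i *: p (lift ord0 i).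
Proof.
have basis_p : basis_of fullv [tuple p (lift ord0 i) | i < n].
  by rewrite basisEfree p_free subvf dimvf size_tuple /dim/= mul1n leqnn.
exists (coord [tuple p (lift ord0 i) | i < n] ^~ v).
rewrite {1}(coord_basis basis_p (memvf v)).
by apply: eq_bigr => i _; rewrite -tnth_nth tnth_mktuple.
Qed.

(** Approximating [q] shifted by [d = e / 4] in every coordinate, to within [d], keeps [r] in the
    orthant and within [2 d < e] of [q]. *)
Lemma orthant_lattice_density (q : 'rV[R]_n) (e : R) :
  nonneg_orthant R n q -> 0 < e ->
  exists (m : nat) (k : 'I_n -> int),
    let r := m%:R *: p ord0 + \sum_i (k i)%:~R *: p (lift ord0 i) in
    nonneg_orthant R n r /\ ball q e r.
Proof.
move=> q0 e0.
(* Coefficient errors below [d / P] in the basis [p] give coordinate errors of at most [d]. *)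
pose P : R := 1 + \sum_i \sum_j `|p (lift ord0 i) ord0 j|.
have P0 : 0 < P by rewrite ltr_pwDl// sumr_ge0// => i _; rewrite sumr_ge0.
pose d : R := e / 4.
have d0 : 0 < d by rewrite divr_gt0.
have [beta betaE] := free_span_row (q + const_mx d).
have [m [k mk]] := kronecker_density alpha_indep beta (divr_gt0 d0 P0).
exists m, k => r.
have rE : r = \sum_i (m%:R * alpha i + (k i)%:~R) *: p (lift ord0 i).
  rewrite /r p0E scaler_sumr -big_split /=; apply: eq_bigr => i _.
  by rewrite scalerA -scalerDl.
have close j : `|r ord0 j - (q ord0 j + d)| <= d.
  have -> : q ord0 j + d = (q + const_mx d) ord0 j by rewrite !mxE.
  rewrite betaE rE !summxE -sumrB; under eq_bigr do rewrite !mxE -mulrBl.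
  apply: (le_trans (ler_norm_sum _ _ _)).
  apply: (@le_trans _ _ (\sum_i d / P * `|p (lift ord0 i) ord0 j|)).
    by apply: ler_sum => i _; rewrite normrM ler_wpM2r// ltW.
  rewrite -mulr_sumr mulrAC ler_pdivrMr// ler_pM2l//.
  apply: (@le_trans _ _ (\sum_i \sum_j `|p (lift ord0 i) ord0 j|)).
    by apply: ler_sum => i _; rewrite (bigD1 j)//= lerDl sumr_ge0.
  by rewrite lerDr.
split.
  by move=> j; have := close j; have := q0 j; rewrite ler_norml => ? /andP[? ?]; lra.
have e4 : e = 4 * d by rewrite /d mulrC divfK.
split=> // i j; rewrite (_ : i = ord0) ?ord1// -ball_normE /=.
have := close j; rewrite ler_norml => /andP[? ?].
by rewrite ltr_norml; apply/andP; split; lra.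
Qed.

Variables (E : completeNormedModType R) (tau : topology_on E).
Hypothesis tau_hausdorff : hausdorff_space (retopologize tau).
Variables (C : set E) (T : 'rV[R]_n -> E -> E).
Hypothesis T_semigroup : nonexpansive_semigroup tau C T.

Let fixes (z : E) (q : 'rV[R]_n) := nonneg_orthant R n q /\ T q z = z.

Let fixesD z : C z -> forall q r, fixes z q -> fixes z r -> fixes z (q + r).
Proof.
move=> Cz q r [q0 Tq] [r0 Tr]; split; first by move=> i; rewrite mxE addr_ge0.
by rewrite (semigroupD T_semigroup)// Tr.
Qed.

Let fixes_nat_comb z (c : 'I_n.+1 -> nat) : C z -> (forall j, T (p j) z = z) ->
  fixes z (\sum_j (c j)%:R *: p j).
Proof.
move=> Cz Tz.
(* [T 0 z = T 0 (T (p ord0) z) = T (0 + p ord0) z = z]. *)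
have fixes0 : fixes z 0.
  have o0 : nonneg_orthant R n 0 by move=> i; rewrite mxE.
  split => //; rewrite -{1}(Tz ord0) -(semigroupD T_semigroup)//.
  by rewrite add0r Tz.
apply: (big_ind (fixes z)) => //; first exact: fixesD.
move=> j _; elim: (c j) => [|m IH]; first by rewrite scale0r.
by rewrite -natr1 scalerDl scale1r; apply: fixesD.
Qed.

Lemma semigroup_common_fixed_point z : C z -> (forall j, T (p j) z = z) ->
  common_fixed_point C T z.
Proof.
move=> Cz Tz.
have lattice_fix (m : nat) (k : 'I_n -> int) :
    let r := m%:R *: p ord0 + \sum_i (k i)%:~R *: p (lift ord0 i) in
    nonneg_orthant R n r -> T r z = z.
  move=> r r0.
  (* [r + b = a] with [b] and [a] in the semigroup generated by the [p j]. *)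
  pose a j : nat := if unlift ord0 j is Some i
    then (if k i is Posz l then l else 0%N) else m.
  pose b j : nat := if unlift ord0 j is Some i
    then (if k i is Negz l then l.+1 else 0%N) else 0%N.
  have [b0 Tb] := fixes_nat_comb b Cz Tz.
  have [_ Ta] := fixes_nat_comb a Cz Tz.
  rewrite -{1}Tb -(semigroupD T_semigroup)//.
  suff -> : r + \sum_j (b j)%:R *: p j = \sum_j (a j)%:R *: p j by [].
  rewrite !big_ord_recl /= /a /b !unlift_none scale0r add0r /r -addrA -big_split /=.
  congr (_ + _); apply: eq_bigr => i _; rewrite !liftK -scalerDl; congr (_ *: _).
  case: (k i) => l; first by rewrite addr0.
  by rewrite NegzE intrN addNr.
(* It suffices that neighbourhoods of [T q z] and of [z] always meet: both contain [z], which equals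
   [T r z] for a lattice point [r] close to [q]. *)
split => // q q0; apply: tau_hausdorff => A B nA nB.
have /subspace_continuousP/(_ q q0 A nA) := semigroup_continuous T_semigroup Cz.
rewrite nbhs_simpl /= /within /= => /nbhs_ballP[e e0 he].
have [m [k [r0 qr]]] := orthant_lattice_density q0 e0.
exists z; split; last exact: (@nbhs_singleton (retopologize tau)).
by rewrite -(lattice_fix m k r0); exact: he.
Qed.

End semigroup.

Theorem theorem5 (R : realType) (n : nat) (n_ge1 : (1 <= n)%N)
  (E : completeNormedModType R) (dot : {dot E for idfun})
  (hilbertE : induces_norm dot)
  (tau : topology_on E) (tau_hausdorff : hausdorff_space (retopologize tau))
  (C : set E) (C_bounded : bounded_set C) (C_closed : closed C)
  (C_convex : convex_set C)
  (T : 'rV[R]_n -> E -> E) (T_semigroup : nonexpansive_semigroup tau C T)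
  (p : 'I_n.+1 -> 'rV[R]_n)
  (p_ge0 : forall j, nonneg_orthant R n (p j))
  (p_free : free [tuple p (lift ord0 i) | i < n])
  (alpha : 'I_n -> R)
  (alpha_indep :
     linearly_independent_over_Q [tuple of 1 :: [tuple alpha i | i < n]])
  (p0E : p ord0 = \sum_(i < n) alpha i *: p (lift ord0 i))
  (lambda : 'I_n.+1 -> R)
  (lambda01 : forall j, 0 < lambda j < 1)
  (lambda_sum : \sum_(j < n.+1) lambda j = 1)
  (S : E -> E)
  (SE : forall x, C x -> S x = \sum_(j < n.+1) lambda j *: T (p j) x)
  (s t : nat -> R)
  (s01 : forall k, 0 < s k < 1) (t01 : forall k, 0 < t k < 1)
  (s_cvg0 : s @ \oo --> (0 : R)) (t_cvg0 : t @ \oo --> (0 : R))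
  (t_sum : (\sum_(0 <= k <oo) (t k)%:E = +oo)%E)
  (t_var : (\sum_(0 <= k <oo) (`|t k.+1 - t k|)%:E < +oo)%E)
  (u : E) (Cu : C u) :
  [/\ forall k, exists! xk, C xk /\ xk = (1 - s k) *: S xk + s k *: u,
      forall x : nat -> E,
        (forall k, C (x k) /\ x k = (1 - s k) *: S (x k) + s k *: u) ->
        exists2 z, common_fixed_point C T z & x @ \oo --> z
    & forall y : nat -> E,
        C (y 0%N) ->
        (forall k, y k.+1 = (1 - t k) *: S (y k) + t k *: u) ->
        exists2 z, common_fixed_point C T z & y @ \oo --> z].
Proof.
have lambda0 j : 0 < lambda j by case/andP: (lambda01 j).
have T_into j x : C x -> C (T (p j) x) by exact: (semigroup_into T_semigroup).
have T_nonexp j : nonexpansive_on C (T (p j)).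
  exact: (semigroup_nonexpansive T_semigroup).
have S_into x : C x -> C (S x).
  by move=> Cx; rewrite SE//; apply: convex_comb => // j; exact: T_into.
have S_nonexp : nonexpansive_on C S.
  move=> x y Cx Cy; rewrite !SE// -sumrB -[leRHS]mul1r -lambda_sum mulr_suml.
  apply: (le_trans (ler_norm_sum _ _ _)); apply: ler_sum => j _.
  by rewrite -scalerBr normrZ gtr0_norm// ler_pM2l// T_nonexp.
have [D C_diam] := bounded_diam C_bounded.
have [w Cw Tw] : exists2 w, C w & {in enum 'I_n.+1, forall j, T (p j) w = w}.
  apply: (commuting_common_fixpoint hilbertE _ _ C_bounded) => //; first by exists u.
  move=> i j x Cx; rewrite -!(semigroupD T_semigroup)//; first by rewrite addrC.
have S_fix_common z : C z -> S z = z -> common_fixed_point C T z.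
  move=> Cz Sz.
  apply: (semigroup_common_fixed_point p_ge0 p_free alpha_indep p0E
    tau_hausdorff T_semigroup Cz) => j.
  (* The weighted mean of the [v i] is [z - w] and no [v i] is longer, so all of them equal it. *)
  pose v i := T (p i) z - w.
  have vE : \sum_i lambda i *: v i = z - w.
    rewrite -{1}Sz SE// -[X in _ - X]scale1r -lambda_sum scaler_suml -sumrB.
    by apply: eq_bigr => i _; rewrite scalerBr.
  have v_const i : v i = \sum_i lambda i *: v i.
    apply: (convex_comb_extreme hilbertE) => // {}i.
    by rewrite vE /v -{1}(Tw i) ?mem_enum// T_nonexp.
  by have := v_const j; rewrite vE => /addIr.
have x_ex k := resolvent_ex C_closed C_convex S_into S_nonexp Cu (s01 k).
have x_lim (x : nat -> E) (hx : forall k, resolvent_eq C S u (s k) (x k)) :=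
  resolvent_limit hilbertE C_closed C_diam S_into S_nonexp Cu s01 s_cvg0 hx.
split=> [k|x hx|y Cy0 yE].
- exact: x_ex.
- by have [z [Cz xz Sz _]] := x_lim x hx; exists z => //; exact: S_fix_common.
(* The limit of [y] is identified through a resolvent curve, which supplies the inequality
   [z_var]. *)
have /choice[x hx] : forall k, exists x, resolvent_eq C S u (s k) x.
  by move=> k; have [x [hx _]] := x_ex k; exists x.
have [z [Cz _ Sz z_var]] := x_lim x hx; exists z; first exact: S_fix_common.
exact: (halpern_cvg hilbertE C_bounded C_convex S_into S_nonexp Cu Cz Sz
  z_var t01 t_cvg0 t_sum t_var Cy0 yE).
Qed.
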